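(* Suppose $\{g_n\}_{n\in\mathbb{N}_0}\subset\mathrm{G}$. For $n\in\mathbb{N}$ let $\varphi_n\in\Phi$ be the unique global solution of the initial value problem $x'=n\,g_n(t,x)$, $x(0)=0$, and let $\overline{\varphi}_0\in\overline{\Phi}$ be defined by $\overline{\varphi}_0(t):=\inf\{x>0:g_0(t,x)<0\}$. Then $$\Vert g_0-g_n\Vert_{\mathbb{R}_+^2}\xrightarrow{n\to\infty}0\ \implies\ d_{\overline{\Phi}}(\varphi_n,\overline{\varphi}_0)=\Vert E(\overline{\varphi}_0)-\varphi_n^{-1}\Vert_{\mathbb{R}_+}\xrightarrow{n\to\infty}0.$$
   Context: $\mathbb{R}_+=[0,\infty)$, $\mathbb{N}_0=\{0,1,2,\dots\}$. $\mathrm{G}\subset C(\mathbb{R}_+^2,\mathbb{R})$ is the set of continuous $g:\mathbb{R}_+^2\to\mathbb{R}$, $(t,x)\mapsto g(t,x)$, such that: (i) $g(0,0)\ge0$; (ii) $g(\cdot,x)$ is strictly increasing for each $x\in\mathbb{R}_+$; (iii) $\inf_{x\in\mathbb{R}_+}g(t,x)<0$ for all $t\in\mathbb{R}_+$; (iv) $\sup_{t\in\mathbb{R}_+}g(t,x)>0$ for all $x\in\mathbb{R}_+$. $\Phi$ is the set of bijective paths in $C^1_0(\mathbb{R}_+,\mathbb{R}_+)$ (continuously differentiable bijections of $\mathbb{R}_+$ starting from $0$). For $g\in\mathrm{G}$ the problem $x'=g(t,x)$, $x(0)=0$ has a unique global solution over $\mathbb{R}_+$, and it lies in $\Phi$ (note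 $n g_n\in\mathrm{G}$ for $n\ge1$). $\overline{\Phi}\supset\Phi$ is the set of strictly increasing càdlàg paths $\overline{\varphi}\in D(\mathbb{R}_+,\mathbb{R}_+)$ with $\lim_{t\to\infty}\overline{\varphi}(t)=\infty$. Exit-time functional: $E(\overline{\varphi})(x):=\inf\{t>0:\overline{\varphi}(t)>x\}$ for $x\in\mathbb{R}_+$; on $\Phi$ it coincides with the inverse, $E(\varphi)=\varphi^{-1}$. Exit-time metric on $\overline{\Phi}$: $d_{\overline{\Phi}}(\overline{\varphi}_1,\overline{\varphi}_2):=\Vert E(\overline{\varphi}_2)-E(\overline{\varphi}_1)\Vert_{\mathbb{R}_+}$. Norms: $\Vert w\Vert_{\mathbb{R}_+}:=\sum_{n\in\mathbb{N}}2^{-n}(1\wedge\sup_{t\in[0,n]}|w(t)|)$ and $\Vert g\Vert_{\mathbb{R}_+^2}:=\sum_{n\in\mathbb{N}}2^{-n}(1\wedge\sup_{[0,n]^2}|g|)$. *)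

(* Defs.v *)
From mathcomp Require Export all_boot all_order all_algebra.
From mathcomp Require Export all_classical all_reals all_analysis.
Export Order.TTheory GRing.Theory Num.Theory numFieldNormedType.Exports.

Set Implicit Arguments.
Unset Strict Implicit.
Unset Printing Implicit Defensive.

Local Open Scope classical_set_scope.
Local Open Scope ring_scope.

(* Functions on [0, oo[ and [0, oo[ ^ 2 are represented by total functions on R
   and R * R; every notion below only looks at their values on these subsets. *)
Definition Rplus (R : realType) : set R := [set t | 0 <= t].
Arguments Rplus : clear implicits.

(* The infimum in (iii) and the supremum in (iv) may be infinite, hence the
   extended reals. *)
Record classG (R : realType) (g : R * R -> R) : Prop := ClassG {
  classG_continuous : {within Rplus R `*` Rplus R, continuous g} ;
  classG_00 : 0 <= g (0, 0) ;
  classG_increasing : forall x : R, 0 <= x ->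
    forall s t : R, 0 <= s -> s < t -> g (s, x) < g (t, x) ;
  classG_inf : forall t : R, 0 <= t ->
    (ereal_inf [set (g (t, x))%:E | x in Rplus R] < 0)%E ;
  classG_sup : forall x : R, 0 <= x ->
    (0 < ereal_sup [set (g (t, x))%:E | t in Rplus R])%E }.

(* Derivative at t of a function defined on [0, oo[; one-sided at t = 0. *)
Definition has_derive_Rplus (R : realType) (f : R -> R) (t l : R) : Prop :=
  (f s - f t) / (s - t) @[s --> within (Rplus R) t^'] --> l.

Definition C1_0 (R : realType) (phi : R -> R) : Prop :=
  [/\ set_fun (Rplus R) (Rplus R) phi, phi 0 = 0 &
      exists2 dphi : R -> R, {within Rplus R, continuous dphi} &
        forall t : R, 0 <= t -> has_derive_Rplus phi t (dphi t)].

Definition Phi (R : realType) (phi : R -> R) : Prop :=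
  C1_0 phi /\ set_bij (Rplus R) (Rplus R) phi.

Definition cadlag (R : realType) (phi : R -> R) : Prop :=
  (forall t : R, 0 <= t -> phi s @[s --> t^'+] --> phi t) /\
  (forall t : R, 0 < t -> exists l : R, phi s @[s --> t^'-] --> l).

Definition Phi_bar (R : realType) (phi : R -> R) : Prop :=
  [/\ set_fun (Rplus R) (Rplus R) phi, cadlag phi,
      (forall s t : R, 0 <= s -> s < t -> phi s < phi t) &
      phi t @[t --> +oo%R] --> +oo%R].

(* Global solution over [0, oo[ of x' = f(t,x), x(0) = 0; it has to stay in
   [0, oo[ because f is only given on [0, oo[ ^ 2. *)
Definition global_solution (R : realType) (f : R * R -> R) (phi : R -> R) :
    Prop :=
  [/\ set_fun (Rplus R) (Rplus R) phi, phi 0 = 0 &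
      forall t : R, 0 <= t -> has_derive_Rplus phi t (f (t, phi t))].

(* The real-valued inf is 0 on the empty set; for phi in Phi_bar the set below
   is never empty, since phi is unbounded. *)
Definition exit_time (R : realType) (phi : R -> R) (x : R) : R :=
  inf [set t : R | 0 < t /\ x < phi t].

(* For g in classG and t >= 0 the set below is nonempty, by classG_inf and
   continuity. *)
Definition zero_path (R : realType) (g : R * R -> R) (t : R) : R :=
  inf [set x : R | 0 < x /\ g (t, x) < 0].

(* Inverse of phi as a map from [0, oo[ to itself. *)
Definition path_inv (R : realType) (phi : R -> R) : R -> R :=
  'pinv_(fun=> 0) (Rplus R) phi.

(* The suprema are taken in the extended reals, so that a function which is
   unbounded on [0, n] contributes 2 ^- n. *)
Definition norm_Rplus (R : realType) (w : R -> R) : \bar R :=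
  (\sum_(1 <= n <oo) (2 ^- n)%:E *
     mine 1 (ereal_sup [set `|w t|%:E | t in `[0%R, n%:R]]))%E.

Definition norm_Rplus2 (R : realType) (g : R * R -> R) : \bar R :=
  (\sum_(1 <= n <oo) (2 ^- n)%:E *
     mine 1 (ereal_sup [set `|g p|%:E | p in `[0%R, n%:R] `*` `[0%R, n%:R]]))%E.

Definition dist_Phi_bar (R : realType) (phi1 phi2 : R -> R) : \bar R :=
  norm_Rplus (exit_time phi2 \- exit_time phi1).

(* Main.v *)
(* If g_0(t, x) < 0, then for large n the field n g_n is negative on
   [0, t] x {x}, so phi_n cannot have crossed the level x by time t; hence
   limsup phi_n(t) <= phi0(t).  If y < phi0(s) and r > s, then g_0(r, .) is
   bounded below by some d > 0 on [0, y], so after time r the path phi_n climbs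
   at speed at least n d / 2 as long as it stays below y; hence
   liminf phi_n(t) >= phi0(s) for s < t.  Since phi0 is strictly increasing, the
   two bounds on a finite time grid show that phi_n and phi0 agree up to a small
   shift of time, and a shift of time by d moves exit times by at most d. *)
Require Import Defs.
From mathcomp Require Import ring lra.

Local Open Scope classical_set_scope.
Local Open Scope ring_scope.

(** * Continuity and the mean value theorem on the closed half-line *)

Section Rplus_calculus.
Variable R : realType.
Implicit Types (f phi : R -> R) (g : R * R -> R).

Lemma dist_within_itv_continuous f (a b : R) :
  (forall t, a <= t -> t <= b -> forall e, 0 < e -> exists2 d, 0 < d &
    forall s, a <= s -> s <= b -> `|s - t| < d -> `|f s - f t| < e) ->
  {within `[a, b], continuous f}.
Proof.
move=> fc; apply/subspace_continuousP => t /=; rewrite in_itv /= => /andP[at_ tb].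
apply/cvgrPdist_lt => e e0; have [d d0 fd] := fc t at_ tb e e0.
apply/nbhs_ballP; exists d => //= s; rewrite /ball /= => st.
by rewrite in_itv /= => /andP[as_ sb]; rewrite distrC fd// distrC.
Qed.

Lemma dist_within_Rplus_continuous f :
  (forall t, 0 <= t -> forall e, 0 < e -> exists2 d, 0 < d &
    forall s, 0 <= s -> `|s - t| < d -> `|f s - f t| < e) ->
  {within Rplus R, continuous f}.
Proof.
move=> fc; apply/subspace_continuousP => t /= t0.
apply/cvgrPdist_lt => e e0; have [d d0 fd] := fc t t0 e e0.
apply/nbhs_ballP; exists d => //= s; rewrite /ball /= => st.
by rewrite /Rplus /= => s0; rewrite distrC fd// distrC.
Qed.

Lemma within_Rplus2_continuous g :
  {within Rplus R `*` Rplus R, continuous g} ->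
  forall t x : R, 0 <= t -> 0 <= x -> forall e, 0 < e -> exists2 d, 0 < d &
    forall s y, 0 <= s -> 0 <= y -> `|s - t| < d -> `|y - x| < d ->
      `|g (s, y) - g (t, x)| < e.
Proof.
move=> /subspace_continuousP gc t x t0 x0 e e0.
have /cvgrPdist_lt/(_ e e0)/nbhs_ballP[d /= d0 gd] := gc (t, x) (conj t0 x0).
exists d => // s y s0 y0 st yx; rewrite distrC.
apply: (gd (s, y)) => //.
by split; rewrite /ball /= distrC.
Qed.

Lemma has_derive_Rplus_dist phi t l : has_derive_Rplus phi t l ->
  forall e, 0 < e -> exists2 d, 0 < d & forall s, 0 <= s -> s != t ->
    `|s - t| < d -> `|(phi s - phi t) / (s - t) - l| < e.
Proof.
move=> /cvgrPdist_lt dphi e e0.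
have /nbhs_ballP[d /= d0 phid] := dphi e e0.
exists d => // s s0 st sd; rewrite distrC; apply: (phid s) => //.
by rewrite /ball /= distrC.
Qed.

Lemma has_derive_Rplus_continuous phi t l : has_derive_Rplus phi t l ->
  forall e, 0 < e -> exists2 d, 0 < d & forall s, 0 <= s ->
    `|s - t| < d -> `|phi s - phi t| < e.
Proof.
move=> /has_derive_Rplus_dist/(_ 1 ltr01)[d d0 phid] e e0.
have l1 : 0 < `|l| + 1 by rewrite ltr_wpDl.
exists (Num.min d (e / (`|l| + 1))); first by rewrite lt_min d0 divr_gt0.
move=> s s0; rewrite lt_min => /andP[std ste].
have [->|st] := eqVneq s t; first by rewrite subrr normr0.
have st0 : s - t != 0 by rewrite subr_eq0.
have -> : phi s - phi t = (phi s - phi t) / (s - t) * (s - t) by rewrite divfK.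
have q : `|(phi s - phi t) / (s - t)| <= `|l| + 1.
  rewrite -lerBlDl; apply: le_trans (lerB_dist _ _) _.
  exact/ltW/phid.
rewrite normrM; apply: le_lt_trans (ler_wpM2r _ q) _ => //.
by rewrite mulrC -ltr_pdivlMr.
Qed.

Lemma has_derive_Rplus_is_derive phi t l : 0 < t -> has_derive_Rplus phi t l ->
  is_derive t 1 phi l.
Proof.
move=> t0 /has_derive_Rplus_dist phid.
have H : h^-1 *: ((phi \o shift t) (h *: 1) - phi t) @[h --> 0^'] --> l.
  apply/cvgrPdist_lt => e e0; have [d d0 phide] := phid e e0.
  apply/nbhs_ballP; exists (Num.min d t) => /=; first by rewrite lt_min d0.
  move=> h; rewrite /ball /= sub0r normrN lt_min => /andP[hd ht] h0.
  have -> : h *: (1 : R^o) = h by rewrite /GRing.scale /= mulr1.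
  rewrite distrC /GRing.scale /= mulrC.
  have := phide (h + t); rewrite addrK; apply => //.
    by move: ht; rewrite ltr_norml => /andP[ht1 ht2]; lra.
  by rewrite -subr_eq0 addrK.
by apply: DeriveDef; [exact: cvgP H|exact: cvg_lim H].
Qed.

(** The intermediate point lies strictly to the right of [a], so a two-sided derivative exists there
    even when [a = 0]; the one-sided derivative at [0] only serves continuity. *)
Lemma MVT_Rplus phi dphi :
  (forall t, 0 <= t -> has_derive_Rplus phi t (dphi t)) ->
  forall a b, 0 <= a -> a < b ->
    exists2 c, a < c < b & phi b - phi a = dphi c * (b - a).
Proof.
move=> phid a b a0 ab.
have [||c] := @MVT R phi dphi a b ab.
- move=> x; rewrite in_itv /= => /andP[ax xb].
  by apply: has_derive_Rplus_is_derive; [lra|apply: phid; lra].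
- apply: dist_within_itv_continuous => t at_ tb e e0.
  have [|d d0 H] := has_derive_Rplus_continuous _ _ _ (phid t _) e e0; first lra.
  by exists d => // s as_ sb; apply: H; lra.
- by rewrite in_itv /= => cab ->; exists c.
Qed.

End Rplus_calculus.

(** * The zero path of a field in the class G belongs to [Phi_bar] *)

Section Zero_path.
Variables (R : realType) (g : R * R -> R).
Hypothesis gG : classG g.

Let zset t := [set x : R | 0 < x /\ g (t, x) < 0].

Lemma classG_nondecreasing x s t : 0 <= x -> 0 <= s -> s <= t ->
  g (s, x) <= g (t, x).
Proof.
move=> x0 s0; rewrite le_eqVlt => /predU1P[->//|st].
exact/ltW/(classG_increasing gG).
Qed.

Lemma classG_x0_ge0 t : 0 <= t -> 0 <= g (t, 0).
Proof.
by move=> t0; apply: le_trans (classG_00 gG) _; exact: classG_nondecreasing.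
Qed.

Lemma classG_near t x e : 0 <= t -> 0 <= x -> 0 < e -> exists2 d, 0 < d &
  forall s y, 0 <= s -> 0 <= y -> `|s - t| < d -> `|y - x| < d ->
    g (t, x) - e < g (s, y) < g (t, x) + e.
Proof.
move=> t0 x0 e0.
have [d d0 H] := within_Rplus2_continuous _ _ (classG_continuous gG) t x t0 x0 e e0.
exists d => // s y s0 y0 st yx; move: (H s y s0 y0 st yx).
by rewrite ltr_norml => /andP[H1 H2]; apply/andP; split; lra.
Qed.

Lemma classG_near_lt0 t x : 0 <= t -> 0 <= x -> g (t, x) < 0 ->
  exists2 d, 0 < d & forall s y, 0 <= s -> 0 <= y -> `|s - t| < d ->
    `|y - x| < d -> g (s, y) < 0.
Proof.
move=> t0 x0 gtx.
have [|d d0 H] := classG_near t x (- g (t, x)) t0 x0; first lra.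
by exists d => // s y s0 y0 st yx; have /andP[_] := H s y s0 y0 st yx; lra.
Qed.

Lemma classG_near_gt0 t x : 0 <= t -> 0 <= x -> 0 < g (t, x) ->
  exists2 d, 0 < d & forall s y, 0 <= s -> 0 <= y -> `|s - t| < d ->
    `|y - x| < d -> 0 < g (s, y).
Proof.
move=> t0 x0 gtx.
have [|d d0 H] := classG_near t x (g (t, x)) t0 x0; first lra.
by exists d => // s y s0 y0 st yx; have /andP[+ _] := H s y s0 y0 st yx; lra.
Qed.

(** As [g (t, 0)] is at least [g (0, 0)], the field is never negative at [x = 0]; the constraint
    [0 < x] in [zero_path] is thus automatic for nonnegative [x]. *)
Lemma classG_lt0_gt0 t x : 0 <= t -> 0 <= x -> g (t, x) < 0 -> 0 < x.
Proof.
move=> t0 x0 gtx; rewrite lt_neqAle x0 andbT; apply/eqP => x00.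
by move: gtx (classG_x0_ge0 t t0); rewrite -x00; lra.
Qed.

Lemma zset_has_inf t : 0 <= t -> has_inf (zset t).
Proof.
move=> t0; split; last by exists 0 => x [/ltW].
have /ereal_inf_lt[_ [x /= x0 <-]] := classG_inf gG t0.
by rewrite lte_fin => gtx; exists x; split => //; exact: classG_lt0_gt0 gtx.
Qed.

Lemma zero_path_ge0 t : 0 <= t -> 0 <= zero_path g t.
Proof.
move=> t0; apply: lb_le_inf; first exact: (zset_has_inf t t0).1.
by move=> x [/ltW].
Qed.

Lemma zero_path_le t x : 0 <= t -> 0 <= x -> g (t, x) < 0 -> zero_path g t <= x.
Proof.
move=> t0 x0 gtx; apply: ge_inf; first exact: (zset_has_inf t t0).2.
by split => //; exact: classG_lt0_gt0 gtx.
Qed.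

Lemma zero_path_lt_exists t y : 0 <= t -> zero_path g t < y ->
  exists x, [/\ 0 < x, zero_path g t <= x, x < y & g (t, x) < 0].
Proof.
move=> t0 ty.
have [|x [x0 gtx]] := inf_adherent _ (zset_has_inf t t0) (eps := y - zero_path g t).
  lra.
rewrite -/(zero_path g t) => xy; exists x; split => //; last by lra.
by apply: zero_path_le => //; lra.
Qed.

Lemma lt_zero_path_ge0 t x : 0 <= t -> 0 <= x -> x < zero_path g t ->
  0 <= g (t, x).
Proof.
move=> t0 x0 xt; rewrite leNgt; apply/negP => gtx.
by have := zero_path_le t x t0 x0 gtx; lra.
Qed.

(** A positive value would persist on a neighbourhood, but points with negative field occur
    arbitrarily close to the infimum. *)
Lemma zero_path_le0 t : 0 <= t -> g (t, zero_path g t) <= 0.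
Proof.
move=> t0; rewrite leNgt; apply/negP => gt0.
have z0 := zero_path_ge0 t t0.
have [d d0 H] := classG_near_gt0 t _ t0 z0 gt0.
have [|x [x0 zx xd gx]] := zero_path_lt_exists t (zero_path g t + d) t0; first lra.
have := H t x t0 (ltW x0); rewrite subrr normr0 => /(_ d0).
have -> : `|x - zero_path g t| < d by rewrite ger0_norm; lra.
by move=> /(_ isT); lra.
Qed.

(** Strict growth in time makes the field at the earlier time [s] strictly negative at
    [zero_path g t], hence also slightly to the left of that point. *)
Lemma zero_path_lt s t : 0 <= s -> s < t -> zero_path g s < zero_path g t.
Proof.
move=> s0 st; have t0 : 0 <= t by lra.
have z0 := zero_path_ge0 t t0; have gz := zero_path_le0 t t0.
have gs : g (s, zero_path g t) < 0.
  by apply: lt_le_trans gz; exact: (classG_increasing gG).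
have zpos := classG_lt0_gt0 s _ s0 z0 gs.
have [d d0 H] := classG_near_lt0 s _ s0 z0 gs.
(* The maximum with [0] keeps the point in the domain. *)
pose x := Num.max 0 (zero_path g t - d / 2).
have x0 : 0 <= x by rewrite /x le_max lexx.
have xz : x < zero_path g t by rewrite /x gt_max zpos; lra.
have xd : zero_path g t - d / 2 <= x by rewrite /x le_max lexx orbT.
apply: (le_lt_trans _ xz); apply: zero_path_le => //; apply: H => //.
  by rewrite subrr normr0.
by rewrite ltr_norml; apply/andP; split; lra.
Qed.

Lemma zero_path_nondecreasing s t : 0 <= s -> s <= t ->
  zero_path g s <= zero_path g t.
Proof.
move=> s0; rewrite le_eqVlt => /predU1P[->//|st]; exact/ltW/zero_path_lt.
Qed.

(** A point just above [zero_path g t] with negative field at time [t] keeps a negative field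
    shortly after [t]; this caps the later values, and monotonicity bounds them below. *)
Lemma zero_path_right_continuous t : 0 <= t ->
  zero_path g s @[s --> t^'+] --> zero_path g t.
Proof.
move=> t0; apply/cvgrPdist_lt => e e0.
have [|x [x0 zx xe gx]] := zero_path_lt_exists t (zero_path g t + e) t0; first lra.
have [d d0 H] := classG_near_lt0 t x t0 (ltW x0) gx.
apply/nbhs_ballP; exists d => //= s; rewrite /ball /= => std ts.
have s0 : 0 <= s by lra.
have := zero_path_nondecreasing t s t0 (ltW ts).
have : zero_path g s <= x.
  by apply: zero_path_le; rewrite ?(ltW x0)//; apply: H;
    rewrite ?(ltW x0)// ?subrr ?normr0// distrC.
by move=> *; rewrite ltr_norml; apply/andP; split; lra.
Qed.

(** If the path were bounded with supremum L, (iv) would give a time [T] with the field positive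
    near L. At a late time [u >= T] some point near L has negative field, although the field has not
    decreased since [T]. *)
Lemma zero_path_unbounded M : exists2 t, 0 <= t & M < zero_path g t.
Proof.
have [//|H] := pselect (exists2 t, 0 <= t & M < zero_path g t).
have bd t : 0 <= t -> zero_path g t <= M.
  by move=> t0; rewrite leNgt; apply/negP => Mt; apply: H; exists t.
pose A := [set zero_path g t | t in Rplus R].
have A0 : A (zero_path g 0) by exists 0 => //; exact: lexx.
have supA : has_sup A.
  split; first by exists (zero_path g 0).
  by exists M => _ [t t0 <-]; exact: bd.
have LA t : 0 <= t -> zero_path g t <= sup A.
  by move=> t0; apply: ub_le_sup; [exact: supA.2|exists t].
have L0 : 0 <= sup A by apply: le_trans (LA 0 _) => //; exact: zero_path_ge0.
have /ereal_sup_gt[_ [T /= T0 <-]] := classG_sup gG L0.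
rewrite lte_fin => gT.
have [d d0 Hd] := classG_near_gt0 T _ T0 L0 gT.
have [_ [t t0 <-] tA] := sup_adherent d0 supA.
pose u := Num.max t T.
have u0 : 0 <= u by rewrite /u le_max; apply/orP; left.
have tu : t <= u by rewrite /u le_max lexx.
have Tu : T <= u by rewrite /u le_max lexx orbT.
have uA := LA u u0; have tz := zero_path_nondecreasing t u t0 tu.
have [|x [x0 zx xe gx]] := zero_path_lt_exists u (zero_path g u + d) u0; first lra.
have gTx : 0 < g (T, x).
  apply: Hd => //; rewrite ?(ltW x0)// ?subrr ?normr0//.
  by rewrite ltr_norml; apply/andP; split; lra.
by have := classG_nondecreasing x T u (ltW x0) T0 Tu; lra.
Qed.

Lemma zero_path_Phi_bar : Phi_bar (zero_path g).
Proof.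
split.
- by move=> t; exact: zero_path_ge0.
- split=> [t|t t0]; first exact: zero_path_right_continuous.
  (* The left limit exists by monotonicity, with [zero_path g t] as upper bound. *)
  apply/cvg_ex; apply: nondecreasing_at_left_is_cvgr.
    near=> x; have x0 : 0 <= x by near: x; exact: nbhs_left_ge.
    move=> a b; rewrite !in_itv /= => /andP[xa _] _.
    by apply: zero_path_nondecreasing; exact: le_trans (ltW xa).
  near=> x; have x0 : 0 <= x by near: x; exact: nbhs_left_ge.
  exists (zero_path g t) => _ [y /= + <-].
  rewrite in_itv /= => /andP[xy yt].
  by apply: zero_path_nondecreasing (ltW yt); exact: le_trans (ltW xy).
- exact: zero_path_lt.
- apply/cvgryPge => M; have [t t0 Mt] := zero_path_unbounded M.
  near=> s; apply: (le_trans (ltW Mt)); apply: zero_path_nondecreasing => //.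
Unshelve. all: by end_near. Qed.

(** Below the zero path at time [s] the field is nonnegative, so it is positive at the later time
    [t]; compactness of [[0, y]] makes the bound uniform. *)
Lemma classG_pos_below_zero_path y s t : 0 <= y -> 0 <= s -> s < t ->
  y < zero_path g s ->
  exists2 d, 0 < d & forall x, 0 <= x -> x <= y -> d <= g (t, x).
Proof.
move=> y0 s0 st ys; have t0 : 0 <= t by lra.
have [|c] := @EVT_min R (fun x => g (t, x)) 0 y y0.
  apply: dist_within_itv_continuous => x x0 xy e e0.
  have [d d0 H] := within_Rplus2_continuous _ _ (classG_continuous gG) t x t0 x0 e e0.
  by exists d => // z z0 zy zx; apply: H => //; rewrite subrr normr0.
rewrite in_itv /= => /andP[c0 cy] cmin.
exists (g (t, c)); last by move=> x x0 xy; apply: cmin; rewrite in_itv /= x0.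
apply: le_lt_trans (classG_increasing gG c0 s0 st).
by apply: lt_zero_path_ge0 => //; lra.
Qed.

End Zero_path.

(** * Solutions driven by a positive multiple of the field: monotone, unbounded, in [Phi] *)

Section Solution.
Variables (R : realType) (g : R * R -> R) (c : R) (phi : R -> R).
Hypotheses (gG : classG g) (c0 : 0 < c).
Hypothesis sol : global_solution (fun p => c * g p) phi.

Let phi_ge0 t : 0 <= t -> 0 <= phi t.
Proof. by case: sol => + _ _ => /[apply]. Qed.

Let phi0 : phi 0 = 0. Proof. by case: sol. Qed.

Lemma solution_MVT a b : 0 <= a -> a < b ->
  exists2 u, a < u < b & phi b - phi a = c * g (u, phi u) * (b - a).
Proof.
case: sol => _ _ dphi a0 ab.
exact: (MVT_Rplus _ phi (fun t => c * g (t, phi t))).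
Qed.

Lemma solution_continuous t : 0 <= t -> forall e, 0 < e -> exists2 d, 0 < d &
  forall s, 0 <= s -> `|s - t| < d -> `|phi s - phi t| < e.
Proof.
case: sol => _ _ dphi t0; exact: has_derive_Rplus_continuous (dphi t t0).
Qed.

(* The field points downwards along [0, t] x {x}, so the solution cannot cross
   the level x before time t. *)
Lemma solution_barrier t x : 0 <= t -> 0 <= x -> g (t, x) < 0 -> phi t < x.
Proof.
move=> t0 x0 gtx; have x_gt0 := classG_lt0_gt0 _ _ gG t x t0 x0 gtx.
rewrite ltNge; apply/negP => xt.
(* The infimum of [A], later called [s1], is the first time at which the level [x] is reached. *)
pose A := [set s | 0 <= s /\ x <= phi s].
have infA : has_inf A by split; [exists t|exists 0 => s []].
have s1_le s : 0 <= s -> x <= phi s -> inf A <= s.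
  by move=> s0 xs; apply: ge_inf; [exact: infA.2|split].
have s1_ge0 : 0 <= inf A by apply: lb_le_inf; [exists t|move=> s []].
move: (inf A) (fun e e0 => @inf_adherent R A e e0 infA) s1_le s1_ge0.
move=> s1 s1_adh s1_le s1_ge0.
have xs1 : x <= phi s1.
  rewrite leNgt; apply/negP => s1x.
  have [|d d0 H] := solution_continuous s1 s1_ge0 (x - phi s1); first lra.
  have [s [s0 xs] sd] := s1_adh d d0.
  have ss1 := s1_le s s0 xs.
  have : `|s - s1| < d by rewrite ger0_norm; lra.
  by move=> /(H s s0); rewrite ltr_norml => /andP[_]; lra.
have s1_gt0 : 0 < s1.
  rewrite lt_neqAle s1_ge0 andbT; apply/eqP => s10.
  by move: xs1; rewrite -s10 phi0; lra.
have left_pt d : 0 < d -> exists u, [/\ 0 <= u, u < s1 & s1 - u < d].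
  move=> d0; have [sd|sd] := leP s1 (d / 2).
    by exists 0; split => //; lra.
  by exists (s1 - d / 2); split; lra.
have s1x : phi s1 <= x.
  rewrite leNgt; apply/negP => s1x.
  have [|d d0 H] := solution_continuous s1 s1_ge0 (phi s1 - x); first lra.
  have [u [u0 us1 ud]] := left_pt d d0.
  have : `|u - s1| < d by rewrite ltr0_norm; lra.
  move=> /(H u u0); rewrite ltr_norml => /andP[H1 _].
  by have := s1_le u u0; lra.
have gs1 : g (s1, x) < 0.
  by apply: le_lt_trans gtx; apply: classG_nondecreasing => //; exact: s1_le.
have [d1 d10 H1] := classG_near_lt0 _ _ gG s1 x s1_ge0 x0 gs1.
have [d2 d20 H2] := solution_continuous s1 s1_ge0 d1 d10.
have [|u [u0 us1]] := left_pt (Num.min d1 d2); first by rewrite lt_min d10.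
rewrite lt_min => /andP[ud1 ud2].
(* Just before [s1] the slope is negative, so the path was already above [x] at [u < s1], against
   the choice of [s1]. *)
have [v /andP[uv vs1] E] := solution_MVT u s1 u0 us1.
have v0 : 0 <= v by lra.
have gv : g (v, phi v) < 0.
  apply: H1 => //; first exact: phi_ge0.
    by rewrite ltr0_norm; lra.
  have -> : x = phi s1 by lra.
  by apply: H2 => //; rewrite ltr0_norm; lra.
have : c * g (v, phi v) * (s1 - u) < 0.
  by rewrite pmulr_llt0 ?subr_gt0// pmulr_rlt0.
by move=> ?; have := s1_le u u0; lra.
Qed.

(** The barrier at the level [phi t] itself would give [phi t < phi t]. *)
Lemma solution_field_ge0 t : 0 <= t -> 0 <= g (t, phi t).
Proof.
move=> t0; rewrite leNgt; apply/negP => gt.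
by have := solution_barrier t (phi t) t0 (phi_ge0 t t0) gt; rewrite ltxx.
Qed.

Lemma solution_nondecreasing s t : 0 <= s -> s <= t -> phi s <= phi t.
Proof.
move=> s0; rewrite le_eqVlt => /predU1P[->//|st].
have [u /andP[su ut] E] := solution_MVT s t s0 st.
rewrite -subr_ge0 E mulr_ge0 ?mulr_ge0 ?(ltW c0)//; last lra.
by apply: solution_field_ge0; lra.
Qed.

(** On an interval of constancy the mean value theorem, applied to each half, yields two distinct
    times where the field vanishes at the same level, which strict growth in time forbids. *)
Lemma solution_increasing s t : 0 <= s -> s < t -> phi s < phi t.
Proof.
move=> s0 st.
rewrite lt_neqAle solution_nondecreasing ?(ltW st)// andbT; apply/eqP => pst.
have const u : s <= u -> u <= t -> phi u = phi s.
  move=> su ut; apply/eqP; rewrite eq_le {1}pst !solution_nondecreasing//.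
  lra.
have zero a b : s <= a -> a < b -> b <= t -> exists2 u, a < u < b & g (u, phi s) = 0.
  move=> sa ab bt; have a0 : 0 <= a by lra.
  have [u /andP[au ub]] := solution_MVT a b a0 ab.
  rewrite (const a) ?(const b) ?(const u) ?subrr; try lra.
  move/esym/eqP; rewrite mulf_eq0 mulf_eq0 (gt_eqF c0) /= subr_eq0 (gt_eqF ab) orbF.
  by move=> /eqP gu; exists u => //; rewrite au.
have [|||u /andP[su um] gu] := zero s ((s + t) / 2); try lra.
have [|||v /andP[mv vt] gv] := zero ((s + t) / 2) t; try lra.
have u0 : 0 <= u by lra.
have uv : u < v by lra.
by have := classG_increasing gG (phi_ge0 s s0) u0 uv; lra.
Qed.

(** By monotonicity the path stays below [y] up to [t], and the bound [d] valid at time [s] persists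
    later, so the slope is at least [c * d] throughout. *)
Lemma solution_growth s t y d : 0 <= s -> s < t ->
  (forall x, 0 <= x -> x <= y -> d <= g (s, x)) -> phi t <= y ->
  c * d * (t - s) <= phi t.
Proof.
move=> s0 st gd ty.
have [u /andP[su ut] E] := solution_MVT s t s0 st.
have u0 : 0 <= u by lra.
have uy : phi u <= y by apply: le_trans ty; exact/solution_nondecreasing/ltW.
have dg : d <= g (u, phi u).
  apply: le_trans (gd _ (phi_ge0 u u0) uy) _.
  by apply: classG_nondecreasing => //; [exact: phi_ge0|exact: ltW].
have : c * d * (t - s) <= c * g (u, phi u) * (t - s).
  by rewrite ler_wpM2r ?subr_ge0 ?(ltW st)// ler_wpM2l// ltW.
by have := phi_ge0 s s0; lra.
Qed.

Lemma solution_unbounded M : exists2 t, 0 <= t & M < phi t.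
Proof.
wlog M0 : M / 0 <= M.
  move=> H; have [|t t0 Mt] := H (Num.max 0 M); first by rewrite le_max lexx.
  by exists t => //; apply: le_lt_trans Mt; rewrite le_max lexx orbT.
have [s s0 Ms] := zero_path_unbounded _ _ gG M.
have [|d d0 Hd] := classG_pos_below_zero_path _ _ gG M s (s + 1) M0 s0 _ Ms.
  lra.
(* Chosen so that a climb at speed [c * d] from [s + 1] to [t] gains [c * d + M], more than [M]. *)
pose t := s + 2 + M / (c * d).
have cd0 : 0 < c * d by rewrite mulr_gt0.
have Mcd : 0 <= M / (c * d) by rewrite divr_ge0 ?(ltW cd0).
have [s10 st t0] : [/\ 0 <= s + 1, s + 1 < t & 0 <= t] by rewrite /t; split; lra.
exists t => //; rewrite ltNge; apply/negP => tM.
have := solution_growth (s + 1) t M d s10 st Hd tM.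
have -> : c * d * (t - (s + 1)) = c * d + M.
  by rewrite /t; field; rewrite !gt_eqF.
lra.
Qed.

(** The equation itself gives the continuous derivative; bijectivity comes from strict monotonicity,
    unboundedness and the intermediate value theorem. *)
Lemma solution_Phi : Phi phi.
Proof.
case: sol => phi_fun _ dphi; split; split => //.
- exists (fun t => c * g (t, phi t)) => //.
  apply: dist_within_Rplus_continuous => t t0 e e0.
  have ec : 0 < e / c by rewrite divr_gt0.
  have [d1 d10 H1] := within_Rplus2_continuous _ _ (classG_continuous gG)
    t (phi t) t0 (phi_ge0 t t0) (e / c) ec.
  have [d2 d20 H2] := solution_continuous t t0 d1 d10.
  exists (Num.min d1 d2); first by rewrite lt_min d10.
  move=> s s0; rewrite lt_min => /andP[sd1 sd2].
  rewrite -mulrBr normrM gtr0_norm// mulrC -ltr_pdivlMr//.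
  by apply: H1 => //; [exact: phi_ge0|exact: H2].
- move=> s t; rewrite !inE /Rplus /= => s0 t0 E.
  by have [st|st|//] := ltgtP s t;
    have := solution_increasing _ _ _ st; rewrite E ltxx => /(_ _)/negP; case.
- move=> x /= x0; have [t t0 xt] := solution_unbounded x.
  have [||s] := @IVT R phi 0 t x t0.
  + apply: dist_within_itv_continuous => u u0 ut e e0.
    have [d d0 H] := solution_continuous u u0 e e0.
    by exists d => // s s0 _; exact: H.
  + by rewrite phi0 min_l ?max_r ?(ltW xt) ?andbT ?phi_ge0.
  + by rewrite in_itv /= => /andP[s0 st] <-; exists s.
Qed.

Lemma exit_time_solution x : 0 <= x -> exit_time phi x = path_inv phi x.
Proof.
move=> x0; have [_ phi_bij] := solution_Phi.
have [+ _ _] := bijpinv_bij (fun=> 0) phi_bij.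
move=> /(_ x x0); rewrite -/(path_inv phi x) => p0.
have phip : phi (path_inv phi x) = x.
  by rewrite /path_inv pinvK// inE; have [_ _ /(_ x x0)] := phi_bij.
move: (path_inv phi x) p0 phip => p; rewrite /Rplus /= => p0 phip.
rewrite /exit_time.
(* By strict monotonicity the level [x = phi p] is exceeded exactly after [p]. *)
have -> : [set t | 0 < t /\ x < phi t] = [set` `]p, +oo[].
  apply/seteqP; split => t /=; rewrite in_itv /= andbT.
    move=> [t0 xt]; rewrite ltNge; apply/negP => tp.
    by have := solution_nondecreasing t p (ltW t0) tp; lra.
  by move=> pt; split; [lra|rewrite -phip; exact: solution_increasing].
by rewrite inf_itv.
Qed.

End Solution.

(** * The weighted norms and locally uniform convergence *)

Section Norms.
Variable R : realType.
Implicit Types (w : R -> R).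

Lemma norm_Rplus_term_ge0 w n :
  (0 <= (2 ^- n)%:E * mine 1 (ereal_sup [set `|w t|%:E | t in `[0%R, n%:R]]))%E.
Proof.
rewrite mule_ge0 ?lee_fin ?invr_ge0 ?exprn_ge0// le_min lee01 /=.
apply: (le_trans _ (ereal_sup_ubound _)); last first.
  by exists 0 => //=; rewrite in_itv /= lexx /=.
by rewrite lee_fin.
Qed.

Lemma norm_Rplus_ge0 w : (0 <= norm_Rplus w)%E.
Proof. by apply: nneseries_ge0 => n _ _; exact: norm_Rplus_term_ge0. Qed.

Lemma eq_norm_Rplus w1 w2 : (forall t, 0 <= t -> w1 t = w2 t) ->
  norm_Rplus w1 = norm_Rplus w2.
Proof.
move=> w12; apply: eq_eseriesr => n _; congr (_ * mine _ (ereal_sup _))%E.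
apply: eq_imagel => t /=; rewrite in_itv /= => /andP[t0 _].
by rewrite w12.
Qed.

(** The head has weight at most [1 - 2 ^- M], and the geometric tail beyond [N] sums to
    [2 ^- N - 2 ^- M]; keeping the terms in [M] lets the induction close. *)
Lemma dyadic_sum_le (e : R) (N M : nat) : 0 <= e ->
  \sum_(1 <= n < M.+1) 2 ^- n * (if (n <= N)%N then e else 1) <=
  e * (1 - 2 ^- M) + (if (N < M)%N then 2 ^- N - 2 ^- M else 0).
Proof.
move=> e0; elim: M => [|M IH].
  by rewrite big_geq// ltn0 expr0 invr1 subrr mulr0 addr0.
rewrite big_nat_recr//=; apply: le_trans (lerD IH (lexx _)) _.
have half : (2 : R) ^- M = 2 * 2 ^- M.+1.
  by rewrite exprS invfM mulrA divff ?mul1r.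
have p0 : 0 <= (2 : R) ^- M.+1 by rewrite invr_ge0 exprn_ge0.
have ep0 := mulr_ge0 e0 p0.
have [MN|] := ltnP M N.
  by rewrite ltnS [(N <= M)%N]leqNgt MN [(N < M)%N]ltnNge (ltnW MN) /= half; lra.
move=> NM; rewrite ltnS NM; move: NM; rewrite leq_eqVlt => /orP[/eqP->|->].
  by rewrite ltnn half; lra.
by rewrite half; lra.
Qed.

Lemma norm_Rplus_le w N (e : R) : 0 <= e ->
  (forall t, 0 <= t -> t <= N%:R -> `|w t| <= e) ->
  (norm_Rplus w <= (e + 2 ^- N)%:E)%E.
Proof.
move=> e0 we; apply: lime_le.
  by apply: is_cvg_nneseries => n _ _; exact: norm_Rplus_term_ge0.
exists 1%N => // -[//|M _] /=.
apply: (@le_trans _ _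
    (\sum_(1 <= n < M.+1) 2 ^- n * (if (n <= N)%N then e else 1))%:E); last first.
  rewrite lee_fin; apply: le_trans (dyadic_sum_le _ _ _ e0) _.
  have p0 k : 0 <= (2 : R) ^- k by rewrite invr_ge0 exprn_ge0.
  have := mulr_ge0 e0 (p0 M); have := p0 M; have := p0 N.
  by case: ifP => _; lra.
rewrite -sumEFin; apply: lee_sum => n _.
rewrite EFinM lee_wpmul2l ?lee_fin ?invr_ge0 ?exprn_ge0//.
case: ifPn => [nN|_]; last by rewrite ge_min lexx.
rewrite ge_min; apply/orP; right; apply: ge_ereal_sup => _ [t /= + <-].
rewrite in_itv /= => /andP[t0 tn]; rewrite lee_fin we//.
by apply: le_trans tn _; rewrite ler_nat.
Qed.

Lemma norm_Rplus_cvg0 (w : nat -> R -> R) :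
  (forall (N : nat) (e : R), 0 < e -> \forall n \near \oo,
    forall t, 0 <= t -> t <= N%:R -> `|w n t| <= e) ->
  norm_Rplus (w n) @[n --> \oo] --> 0%E.
Proof.
move=> wcvg.
have small (e : R) : 0 < e -> \forall n \near \oo, (norm_Rplus (w n) <= e%:E)%E.
  move=> e0; have e20 : 0 < e / 2 by rewrite divr_gt0.
  (* Half of [e] pays for the tail beyond [N], the other half for the uniform bound on [[0, N]]. *)
  have [N _ HN] : \forall N \near \oo, (2 : R) ^- N < e / 2.
    have : (2 : R)^-1 ^+ n @[n --> \oo] --> 0.
      by apply: cvg_expr; rewrite ger0_norm; lra.
    move=> /cvgrPdist_lt/(_ _ e20); apply: filterS => n.
    by rewrite sub0r normrN ger0_norm ?exprVn// invr_ge0 exprn_ge0.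
  apply: filterS (wcvg N _ e20) => n wn.
  apply: le_trans (norm_Rplus_le _ _ _ (ltW e20) wn) _.
  by rewrite lee_fin; have := HN N (leqnn N); lra.
apply/fine_cvgP; split.
  apply: filterS (small 1 ltr01) => n wn1.
  rewrite ge0_fin_numE ?norm_Rplus_ge0//.
  by apply: le_lt_trans wn1 _; rewrite ltry.
apply/cvgrPdist_le => e e0; apply: filterS (small e e0) => n /= wne.
rewrite sub0r normrN ger0_norm ?fine_ge0 ?norm_Rplus_ge0//.
by rewrite -lee_fin fineK// ge0_fin_numE ?norm_Rplus_ge0// (le_lt_trans wne)// ltry.
Qed.

(** The [N]-th term alone is below the whole series, and [e <= 1] ensures that the truncation at [1]
    does not hide the supremum. *)
Lemma norm_Rplus2_lt (w : R * R -> R) N (e : R) : (0 < N)%N -> e <= 1 ->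
  (norm_Rplus2 w < (2 ^- N * e)%:E)%E ->
  forall t x, 0 <= t -> t <= N%:R -> 0 <= x -> x <= N%:R -> `|w (t, x)| < e.
Proof.
move=> N0 e1 we t x t0 tN x0 xN.
pose S n := ereal_sup [set `|w p|%:E | p in `[0%R, n%:R] `*` `[0%R, n%:R]].
have S0 n : (0 <= S n)%E.
  apply: (le_trans _ (ereal_sup_ubound _)); last first.
    by exists (0, 0) => //; split; rewrite /= in_itv /= lexx /=.
  by rewrite lee_fin.
have term0 n : (0 <= (2 ^- n)%:E * mine 1 (S n))%E.
  by rewrite mule_ge0 ?lee_fin ?invr_ge0 ?exprn_ge0// le_min lee01 /=.
have p0 : 0 < (2 : R) ^- N by rewrite invr_gt0 exprn_gt0.
have : ((2 ^- N)%:E * mine 1 (S N) < (2 ^- N * e)%:E)%E.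
  apply: le_lt_trans we.
  apply: (@le_trans _ _ (\sum_(1 <= n < N.+1) (2 ^- n)%:E * mine 1 (S n))%E).
    by rewrite big_nat_recr//= leeDr// sume_ge0.
  by apply: nneseries_lim_ge => n _ _; exact: term0.
rewrite EFinM lte_pmul2l ?lte_fin//.
rewrite gt_min => /orP[|]; first by rewrite lte_fin; lra.
move=> SN; rewrite -lte_fin; apply: le_lt_trans SN.
by apply: ereal_sup_ubound; exists (t, x) => //; split; rewrite /= in_itv /= ?t0 ?x0.
Qed.

Lemma norm_Rplus2_cvg0 (w : nat -> R * R -> R) :
  norm_Rplus2 (w n) @[n --> \oo] --> 0%E ->
  forall (N : nat) (e : R), 0 < e -> \forall n \near \oo, forall t x,
    0 <= t -> t <= N%:R -> 0 <= x -> x <= N%:R -> `|w n (t, x)| < e.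
Proof.
move=> w0 N e e0; pose e' := Num.min 1 e.
have e'0 : 0 < e' by rewrite lt_min ltr01.
(* The index [N.+1] avoids [N = 0], since the series starts at [1]. *)
have : \forall n \near \oo, (norm_Rplus2 (w n) < (2 ^- N.+1 * e')%:E)%E.
  apply: (w0 [set u | (u < (2 ^- N.+1 * e')%:E)%E]); apply: open_ereal_lt'.
  by rewrite lte_fin mulr_gt0// invr_gt0 exprn_gt0.
apply: filterS => n wn t x t0 tN x0 xN.
have NN : N%:R <= N.+1%:R :> R by rewrite ler_nat.
apply: (@lt_le_trans _ _ e'); last by rewrite /e' ge_min lexx orbT.
apply: (norm_Rplus2_lt _ N.+1 _ _ _ wn) => //; try exact: le_trans NN.
by rewrite /e' ge_min lexx.
Qed.

End Norms.

(** Whenever [phi] is above [x] at a time [t <= T], [psi] is above [x] at [t + d]. Later times are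
    handled by comparison with [T], where [phi] is already above [x]. *)
Lemma exit_time_shift (R : realType) (phi psi : R -> R) (T d x : R) :
  0 < T -> 0 < d -> (forall t, 0 <= t -> t <= T -> phi t < psi (t + d)) ->
  x < phi T -> exit_time psi x <= exit_time phi x + d.
Proof.
move=> T0 d0 phipsi xT; rewrite -lerBlDr; apply: lb_le_inf; first by exists T.
have psiE t : 0 < t -> t <= T -> x < phi t -> exit_time psi x <= t + d.
  move=> t0 tT xt; apply: ge_inf; first by exists 0 => s [/ltW].
  by split; [lra|apply: lt_trans xt (phipsi _ (ltW t0) tT)].
move=> t [t0 xt]; have [tT|Tt] := leP t T.
  by have := psiE t t0 tT xt; lra.
by have := psiE T T0 (lexx _) xT; lra.
Qed.

(** * Convergence of the solutions and of their exit times *)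

Section Convergence.
Variables (R : realType) (g : nat -> R * R -> R) (phi : nat -> R -> R).
Hypothesis g_G : forall n, classG (g n).
Hypothesis phi_sol : forall n, (0 < n)%N ->
  global_solution (fun p => n%:R * g n p) (phi n).
Hypothesis g_cvg : norm_Rplus2 (g 0%N \- g n) @[n --> \oo] --> 0%E.

Local Notation phi0 := (zero_path (g 0%N)).

Lemma g_cvg_at (M e : R) : 0 < e -> \forall n \near \oo, forall t x,
  0 <= t -> t <= M -> 0 <= x -> x <= M -> `|g 0%N (t, x) - g n (t, x)| < e.
Proof.
move=> e0; pose N := (Num.truncn M).+1.
have MN : M <= N%:R by apply/ltW/truncnS_gt.
apply: filterS (norm_Rplus2_cvg0 _ _ g_cvg N e e0) => n H t x t0 tM x0 xM.
by apply: H => //; exact: le_trans MN.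
Qed.

Lemma phi_eventually_lt t y : 0 <= t -> phi0 t < y ->
  \forall n \near \oo, phi n t < y.
Proof.
move=> t0 ty.
have [x [x0 _ xy gx]] := zero_path_lt_exists _ _ (g_G 0%N) t y t0 ty.
near=> n.
have n0 : (0 < n)%N by near: n; exists 1%N.
apply: lt_trans xy.
apply: (solution_barrier _ _ _ _ (g_G n) _ (phi_sol n n0)); rewrite ?ltr0n// ?ltW//.
have : `|g 0%N (t, x) - g n (t, x)| < - g 0%N (t, x).
  near: n; apply: filterS (g_cvg_at (Num.max t x) (- g 0%N (t, x)) _).
    by move=> n; apply; rewrite ?le_max ?lexx ?orbT// ltW.
  lra.
by rewrite ltr_norml => /andP[+ _]; lra.
Unshelve. all: by end_near. Qed.

Lemma phi_eventually_gt s t y : 0 <= s -> s < t -> 0 <= y -> y < phi0 s ->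
  \forall n \near \oo, y < phi n t.
Proof.
(* The wait from [s] to [r] makes the limit field uniformly positive on [[0, y]]; the time from [r]
   to [t] is left for climbing. *)
move=> s0 st y0 ys; pose r := (s + t) / 2.
have [sr rt r0] : [/\ s < r, r < t & 0 <= r] by rewrite /r; split; lra.
have [d d0 gd] := classG_pos_below_zero_path _ _ (g_G 0%N) y s r y0 s0 sr ys.
have dr : 0 < d / 2 * (t - r) by rewrite mulr_gt0; lra.
near=> n.
have n0 : (0 < n)%N by near: n; exists 1%N.
rewrite ltNge; apply/negP => ty.
have gnd x : 0 <= x -> x <= y -> d / 2 <= g n (r, x).
  have H : forall u x, 0 <= u -> u <= Num.max r y -> 0 <= x -> x <= Num.max r y ->
      `|g 0%N (u, x) - g n (u, x)| < d / 2.
    by near: n; apply: g_cvg_at; lra.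
  move=> x0 xy; have := gd x x0 xy.
  have := H r x r0; rewrite !le_max lexx xy orbT => /(_ isT x0 isT).
  by rewrite ltr_norml => /andP[_]; lra.
have nR : 0 < n%:R :> R by rewrite ltr0n.
have := solution_growth _ _ _ _ (g_G n) nR (phi_sol n n0) r t y (d / 2) r0 rt gnd ty.
(* For such [n] the climb after [r] exceeds [y], although the path was assumed to stay below. *)
have : y / (d / 2 * (t - r)) < n%:R by near: n; exact: nbhs_infty_gtr.
by rewrite ltr_pdivrMr// mulrA; lra.
Unshelve. all: by end_near. Qed.

(* Both paths are increasing, so it suffices to control them on the grid of
   mesh e. *)
Lemma phi_eventually_shift (e : R) (K : nat) : 0 < e ->
  \forall n \near \oo, forall t, 0 <= t -> t <= K%:R * e ->
    phi n t < phi0 (t + 2 * e) /\ phi0 t < phi n (t + 2 * e).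
Proof.
move=> e0.
have grid (k : nat) : \forall n \near \oo,
    phi n (k%:R * e) < phi0 (k%:R * e + e) /\ phi0 (k%:R * e) < phi n (k%:R * e + e).
  have k0 : 0 <= k%:R * e by rewrite mulr_ge0// ltW.
  apply: filterI.
    by apply: phi_eventually_lt => //; apply: zero_path_lt => //; lra.
  (* Half a mesh makes [phi0] strictly larger than at the grid point; the other half is the delay
     needed by the lower bound. *)
  apply: (phi_eventually_gt (k%:R * e + e / 2)); try lra.
    exact: zero_path_ge0.
  by apply: zero_path_lt => //; lra.
elim: K => [|K IH].
  near=> n; move=> t t0; rewrite mul0r => t0'.
  have n0 : (0 < n)%N by near: n; exists 1%N.
  have nR : 0 < n%:R :> R by rewrite ltr0n.
  have -> : t = 0 by lra.
  have : phi n (0%:R * e) < phi0 (0%:R * e + e) /\ phi0 (0%:R * e) < phi n (0%:R * e + e).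
    by near: n; exact: grid.
  rewrite mul0r !add0r => -[H1 H2]; split.
    apply: lt_le_trans H1 _; apply: zero_path_nondecreasing => //; lra.
  apply: lt_le_trans H2 _.
  by apply: (solution_nondecreasing _ _ _ _ (g_G n) nR (phi_sol n n0)); lra.
near=> n; move=> t t0 tK.
have n0 : (0 < n)%N by near: n; exists 1%N.
have nR : 0 < n%:R :> R by rewrite ltr0n.
have [tK'|Kt] := leP t (K%:R * e); first by move: t t0 tK' {tK}; near: n.
(* For [t] in the last cell, one mesh [e] pays for rounding up to the grid point and one for the
   estimate there, hence the shift [2 * e]. *)
have : phi n (K.+1%:R * e) < phi0 (K.+1%:R * e + e) /\
       phi0 (K.+1%:R * e) < phi n (K.+1%:R * e + e).
  by near: n; exact: grid.
have KE : K.+1%:R * e = K%:R * e + e by rewrite -natr1 mulrDl mul1r.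
move: tK; rewrite KE => tK [H1 H2].
have phi_nd := solution_nondecreasing _ _ _ _ (g_G n) nR (phi_sol n n0).
split.
  apply: le_lt_trans (phi_nd _ _ t0 tK) _; apply: lt_le_trans H1 _.
  by apply: zero_path_nondecreasing => //; lra.
apply: (@le_lt_trans _ _ (phi0 (K%:R * e + e))).
  by apply: zero_path_nondecreasing.
by apply: lt_le_trans H2 _; apply: phi_nd; lra.
Unshelve. all: by end_near. Qed.

Lemma exit_time_cvg : norm_Rplus (exit_time phi0 \- exit_time (phi n)) @[n --> \oo] --> 0%E.
Proof.
apply: norm_Rplus_cvg0 => N e e0.
have [t0 t0_ge0 Nt0] := zero_path_unbounded _ _ (g_G 0%N) N%:R.
pose T := t0 + 1.
have T0 : 0 < T by rewrite /T; lra.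
have NT : N%:R < phi0 T.
  by apply: lt_trans Nt0 _; apply: zero_path_lt => //; rewrite /T; lra.
(* The shift of time is twice the mesh, so this mesh moves exit times by at most [e]. *)
pose h := e / 2.
have h0 : 0 < h by rewrite /h; lra.
pose K := (Num.truncn ((T + e) / h)).+1.
(* The grid must reach [T + e]: [phi0] is above [N] at [T], but [phi n] is only known to be above
   [N] at [T + e]. *)
have TK : T + e <= K%:R * h by rewrite -ler_pdivrMr//; apply/ltW/truncnS_gt.
apply: filterS (phi_eventually_shift h K h0) => n H x x0 xN.
have hE : 2 * h = e by rewrite /h; lra.
rewrite hE in H.
have A1 : exit_time (phi n) x <= exit_time phi0 x + e.
  apply: (exit_time_shift _ _ _ T) => // [t t1 tT|]; last exact: le_lt_trans NT.
  by apply: (H t t1 _).2; lra.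
have A2 : exit_time phi0 x <= exit_time (phi n) x + e.
  apply: (exit_time_shift _ _ _ (T + e)) => // [|t t1 tT|].
  - by rewrite addr_gt0.
  - by apply: (H t t1 _).1; lra.
  - apply: le_lt_trans xN _; apply: lt_trans NT _.
    by apply: (H T (ltW T0) _).2; lra.
by rewrite ler_norml /=; apply/andP; split; lra.
Qed.

End Convergence.

Theorem mainTheorem8 (R : realType) (g : nat -> R * R -> R)
    (phi : nat -> R -> R)
    (g_G : forall n : nat, classG (g n))
    (phi_sol : forall n : nat, (0 < n)%N ->
      global_solution (fun p => n%:R * g n p) (phi n)) :
  let phi0 := zero_path (g 0%N) in
  [/\ forall n : nat, (0 < n)%N -> Phi (phi n),
      Phi_bar phi0 &
      norm_Rplus2 (g 0%N \- g n) @[n --> \oo] --> 0%E ->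
      (forall n : nat, (0 < n)%N ->
         dist_Phi_bar (phi n) phi0 =
         norm_Rplus (exit_time phi0 \- path_inv (phi n))) /\
      dist_Phi_bar (phi n) phi0 @[n --> \oo] --> 0%E].
Proof.
have npos n : (0 < n)%N -> 0 < n%:R :> R by rewrite ltr0n.
split.
- move=> n n0; exact: (solution_Phi _ _ _ _ (g_G n) (npos n n0) (phi_sol n n0)).
- exact: zero_path_Phi_bar.
- move=> g_cvg; split; last exact: exit_time_cvg.
  move=> n n0; apply: eq_norm_Rplus => t t0 /=.
  by rewrite (exit_time_solution _ _ _ _ (g_G n) (npos n n0) (phi_sol n n0)).
Qed.
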